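(* Let $f:\mathbb{R}^d\to\mathbb{R}$ be twice differentiable with $L$-Lipschitz gradient and $M$-Lipschitz Hessian, uniformly bounded below by $\bar f$. Run the algorithm described in the context with tolerances $\epsilon_g,\epsilon_H>0$, where the inexact oracles satisfy at every iteration $k$ $$\|g_k-\nabla f(x_k)\|\le \tfrac13\max\{\epsilon_g,\|g_k\|\},\qquad \|H_k-\nabla^2 f(x_k)\|\le \tfrac29\epsilon_H,\qquad |\hat\lambda_k-\lambda_{\min}(H_k)|\le \tfrac19\epsilon_H .$$ Let $T$ denote the iteration at which the algorithm terminates. Then $T<\infty$ almost surely and $$\mathbb{E}\,T\le \frac{f(x_0)-\bar f}{R_\epsilon},\qquad\text{where } R_\epsilon:=\min\left(\frac{\epsilon_g^2}{6L},\frac{2\epsilon_H^3}{9M^2}\right).$$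
   Context: Norms are the Euclidean norm for vectors and the spectral norm for matrices; Lipschitz continuity of the Hessian is with respect to the spectral norm. Oracles: at the iterate $x_k$ the algorithm receives an approximate gradient $g_k\in\mathbb{R}^d$ and, if requested, a symmetric approximate Hessian $H_k\in\mathbb{R}^{d\times d}$ together with a unit vector $\hat p_k$ (approximate minimum eigenvector of $H_k$) and the value $\hat\lambda_k:=\hat p_k^T H_k\hat p_k$. The oracle outputs may themselves be random. Algorithm: inputs are $\epsilon_g,\epsilon_H>0$, Lipschitz constants $L,M>0$, a number $\alpha\in[\epsilon_H,L]$, and a (deterministic) $x_0\in\mathbb{R}^d$. For $k=0,1,2,\dots$: (i) if $\|g_k\|>\epsilon_g$, set $x_{k+1}=x_k-\frac1L g_k$ (gradient step); (ii) else if $\hat\lambda_k<-\epsilon_H$, choose $\alpha_k\in[\epsilon_H,\min(\alpha,|\hat\lambda_k|)]$, then draw $\sigma_k\in\{+1,-1\}$ with probability $\frac12$ each, and set $x_{k+1}=x_k+\frac{2\alpha_k}{M}\sigma_k\hat p_k$ (negative curvature step); (iii) else terminate and return $x_k$. The draw $\sigma_k$ is independent of everything generated before it: all $\sigma_i$ with $i<k$, and all $x_i,g_i,H_i,\hat p_i,\hat\lambda_i,\alpha_i$ with $i\le k$. *)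

(* Defs.v *)
From HB Require Import structures.
From mathcomp Require Import all_boot all_order all_algebra.
From mathcomp Require Import all_classical all_reals all_analysis.
Import Order.TTheory GRing.Theory Num.Theory.
Import numFieldNormedType.Exports.

Set Implicit Arguments.
Unset Strict Implicit.
Unset Printing Implicit Defensive.

Local Open Scope classical_set_scope.
Local Open Scope ring_scope.

(* Points of R^d are column vectors.  The library norm `|x| on matrices is the
   max norm, so the Euclidean and spectral norms are defined here; the topology
   (hence differentiability) does not depend on that choice. *)
Section euclidean.
Context {R : realType} {d : nat}.

Definition norm2 (v : 'cV[R]_d) : R := Num.sqrt (\sum_(i < d) v i 0 ^+ 2).

Definition spectral_norm (A : 'M[R]_d) : R :=
  sup [set norm2 (A *m v) | v in [set v | norm2 v <= 1]].

(* Used for symmetric A only: the set is then finite, and nonempty for 0 < d,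
   so that the infimum is attained. *)
Definition lambda_min (A : 'M[R]_d) : R := inf [set a | eigenvalue A a].

Definition gradient (f : 'cV[R]_d -> R) (x : 'cV[R]_d) : 'cV[R]_d :=
  \col_i 'D_(delta_mx i 0) f x.

Definition hessian (f : 'cV[R]_d -> R) (x : 'cV[R]_d) : 'M[R]_d :=
  \matrix_(i, j) 'D_(delta_mx j 0) (fun y => gradient f y i 0) x.

Definition twice_differentiable (f : 'cV[R]_d -> R) : Prop :=
  (forall x, differentiable f x) /\ (forall x, differentiable (gradient f) x).

Definition lipschitz_gradient (L : R) (f : 'cV[R]_d -> R) : Prop :=
  forall x y, norm2 (gradient f x - gradient f y) <= L * norm2 (x - y).

Definition lipschitz_hessian (M : R) (f : 'cV[R]_d -> R) : Prop :=
  forall x y, spectral_norm (hessian f x - hessian f y) <= M * norm2 (x - y).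

End euclidean.

Section independence.
Context {dsp : measure_display} {T : measurableType dsp} {R : realType}.

Definition sigma_generated (X : set (T -> R)) : set_system T :=
  <<s \bigcup_(h in X) preimage_set_system [set: T] h measurable >>.

Definition independent (P : probability T R) (F G : set_system T) : Prop :=
  forall A B, F A -> G B -> P (A `&` B) = (P A * P B)%E.

End independence.

Section algorithm.
Context {dsp : measure_display} {T : measurableType dsp} {R : realType}
        {d : nat}.

(* The quantities appearing in an execution, as functions of the iteration
   number and of the outcome.  They are total: entries that the algorithm does
   not produce (after termination, or because no Hessian was requested) are
   mere placeholders. *)
Record execution := Execution {
  iterate   : nat -> T -> 'cV[R]_d;  (* x_k *)
  grad_est  : nat -> T -> 'cV[R]_d;  (* g_k *)
  hess_est  : nat -> T -> 'M[R]_d;   (* H_k *)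
  eigvec    : nat -> T -> 'cV[R]_d;  (* \hat p_k *)
  curv_step : nat -> T -> R;         (* alpha_k *)
  coin      : nat -> T -> R          (* sigma_k *)
}.

Variable E : execution.

Definition eigval (k : nat) (w : T) : R :=
  ((eigvec E k w)^T *m hess_est E k w *m eigvec E k w) 0 0.

Section run.
Variables (eps_g eps_H : R).

Definition stops_at (k : nat) (w : T) : Prop :=
  norm2 (grad_est E k w) <= eps_g /\ - eps_H <= eigval k w.

Definition reached (k : nat) (w : T) : Prop :=
  forall i, (i < k)%N -> ~ stops_at i w.

Definition hessian_requested (k : nat) (w : T) : Prop :=
  reached k w /\ norm2 (grad_est E k w) <= eps_g.

(* Equals +oo when the algorithm never terminates. *)
Definition termination_time (w : T) : \bar R :=
  ereal_inf [set (k%:R)%:E | k in [set k | stops_at k w]].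

Record runs_algorithm (L M alpha : R) (x0 : 'cV[R]_d) : Prop := {
  run_init : forall w, iterate E 0 w = x0;
  run_gradient_step : forall k w,
    reached k w -> eps_g < norm2 (grad_est E k w) ->
    iterate E k.+1 w = iterate E k w - L^-1 *: grad_est E k w;
  run_hessian_oracle : forall k w, hessian_requested k w ->
    (hess_est E k w)^T = hess_est E k w /\ norm2 (eigvec E k w) = 1;
  run_curvature_step : forall k w,
    hessian_requested k w -> eigval k w < - eps_H ->
    eps_H <= curv_step E k w <= Num.min alpha `|eigval k w| /\
    iterate E k.+1 w =
      iterate E k w + (2 * curv_step E k w / M * coin E k w) *: eigvec E k w
}.

Record inexact_oracles (f : 'cV[R]_d -> R) : Prop := {
  oracle_gradient : forall k w, reached k w ->
    norm2 (grad_est E k w - gradient f (iterate E k w))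
      <= 1 / 3 * Num.max eps_g (norm2 (grad_est E k w));
  oracle_hessian : forall k w, hessian_requested k w ->
    spectral_norm (hess_est E k w - hessian f (iterate E k w))
      <= 2 / 9 * eps_H;
  oracle_eigval : forall k w, hessian_requested k w ->
    `|eigval k w - lambda_min (hess_est E k w)| <= 1 / 9 * eps_H
}.

End run.

(* Everything generated before sigma_k, as a family of real-valued functions
   (vectors and matrices are given by their entries). *)
Inductive history (k : nat) : (T -> R) -> Prop :=
| hist_coin i : (i < k)%N -> history k (coin E i)
| hist_iterate i j : (i <= k)%N -> history k (fun w => iterate E i w j 0)
| hist_grad i j : (i <= k)%N -> history k (fun w => grad_est E i w j 0)
| hist_hess i j l : (i <= k)%N -> history k (fun w => hess_est E i w j l)
| hist_eigvec i j : (i <= k)%N -> history k (fun w => eigvec E i w j 0)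
| hist_eigval i : (i <= k)%N -> history k (eigval i)
| hist_step i : (i <= k)%N -> history k (curv_step E i).

Definition random_execution : Prop :=
  forall k h, history k h -> measurable_fun [set: T] h.

Record fair_independent_coins (P : probability T R) : Prop := {
  coin_sign : forall k w, coin E k w = 1 \/ coin E k w = -1;
  coin_fair : forall k,
    P [set w | coin E k w = 1] = (1 / 2)%:E /\
    P [set w | coin E k w = -1] = (1 / 2)%:E;
  coin_independent : forall k,
    independent P (sigma_generated (history k))
                  (sigma_generated [set coin E k])
}.

End algorithm.

Arguments execution {dsp} T R d.

Definition R_eps {R : realType} (eps_g eps_H L M : R) : R :=
  Num.min (eps_g ^+ 2 / (6 * L)) (2 * eps_H ^+ 3 / (9 * M ^+ 2)).

(* Main.v *)
(* On the event that the algorithm has not stopped at iterations 0, ..., k, a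
   gradient step decreases f by at least eps_g^2 / (6 L) (descent lemma), and a
   negative curvature step changes f by at most - 2 eps_H^3 / (9 M^2) plus
   sigma_k Z_k (cubic upper bound along the step), where
   Z_k = 2 alpha_k / M <grad f(x_k), p_k> is bounded and measurable with respect
   to the history.  Since sigma_k is a fair sign independent of the history, the
   last term has mean zero, so that
   E[(f(x_{k+1}) - fbar) 1_{T > k}] + R_eps P(T > k)
     <= E[(f(x_k) - fbar) 1_{T >= k}].
   Summing over k gives R_eps E[T] = R_eps sum_k P(T > k) <= f(x_0) - fbar,
   hence also T < oo almost surely. *)

Require Import Defs.
From mathcomp Require Import all_boot all_order all_algebra.
From mathcomp Require Import all_classical all_reals all_analysis.
From mathcomp Require Import measurable_realfun ring lra.

Set Implicit Arguments.
Unset Strict Implicit.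
Unset Printing Implicit Defensive.

Import Order.TTheory GRing.Theory Num.Theory.
Import numFieldNormedType.Exports.
Local Open Scope classical_set_scope.
Local Open Scope ring_scope.

(** * Euclidean inner product, Cauchy-Schwarz inequality and spectral norm *)

Definition dot {R : realType} {d : nat} (u v : 'cV[R]_d) : R :=
  \sum_(i < d) u i 0 * v i 0.

Lemma dotZr (R : realType) (d : nat) (u v : 'cV[R]_d) (c : R) :
  dot u (c *: v) = c * dot u v.
Proof. by rewrite /dot mulr_sumr; apply: eq_bigr => i _; rewrite mxE mulrCA. Qed.

Lemma dotBl (R : realType) (d : nat) (u v w : 'cV[R]_d) :
  dot (u - v) w = dot u w - dot v w.
Proof.
by rewrite /dot -sumrB; apply: eq_bigr => i _; rewrite !mxE mulrBl.
Qed.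

Lemma dotBr (R : realType) (d : nat) (u v w : 'cV[R]_d) :
  dot u (v - w) = dot u v - dot u w.
Proof.
by rewrite /dot -sumrB; apply: eq_bigr => i _; rewrite !mxE mulrBr.
Qed.

Lemma norm2_ge0 (R : realType) (d : nat) (v : 'cV[R]_d) : 0 <= norm2 v.
Proof. exact: sqrtr_ge0. Qed.

Lemma sqr_norm2 (R : realType) (d : nat) (v : 'cV[R]_d) :
  norm2 v ^+ 2 = dot v v.
Proof.
rewrite sqr_sqrtr; first by apply: eq_bigr => i _; rewrite expr2.
by apply: sumr_ge0 => i _; exact: sqr_ge0.
Qed.

Lemma norm2Z (R : realType) (d : nat) (c : R) (v : 'cV[R]_d) :
  norm2 (c *: v) = `|c| * norm2 v.
Proof.
rewrite /norm2 -sqrtr_sqr -sqrtrM ?sqr_ge0// mulr_sumr.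
by congr Num.sqrt; apply: eq_bigr => i _; rewrite mxE exprMn.
Qed.

(** Cauchy-Schwarz. With [A = dot u u], [B = dot v v], [C = dot u v], the sum of the squares of
    [A * v i 0 - C * u i 0] equals [A * (A * B - C ^+ 2)]; a positive [A] is divided out, and
    [A = 0] forces [u = 0]. *)
Lemma dot_le_norm2M (R : realType) (d : nat) (u v : 'cV[R]_d) :
  `|dot u v| <= norm2 u * norm2 v.
Proof.
rewrite -ler_sqr ?nnegrE ?mulr_ge0 ?norm2_ge0// real_normK ?num_real//.
rewrite exprMn !sqr_norm2.
have expand a c : \sum_(i < d) (a * v i 0 - c * u i 0) ^+ 2
    = a ^+ 2 * dot v v + (- (2 * a * c)) * dot u v + c ^+ 2 * dot u u.
  by rewrite /dot !mulr_sumr -!big_split/=; apply: eq_bigr => i _; ring.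
set A := dot u u in expand *; set C := dot u v in expand *.
set B := dot v v in expand *.
have A0 : 0 <= A by apply: sumr_ge0 => i _; rewrite -expr2 sqr_ge0.
have : 0 <= A * (A * B - C ^+ 2).
  have : 0 <= \sum_(i < d) (A * v i 0 - C * u i 0) ^+ 2.
    by apply: sumr_ge0 => i _; exact: sqr_ge0.
  by rewrite expand; congr (0 <= _); ring.
case: (ltgtP 0 A) A0 => // [A0 _|A0 _ _].
  by rewrite pmulr_rge0// subr_ge0.
have u0 i : u i 0 = 0.
  apply/eqP; rewrite -sqrf_eq0 expr2.
  have /eqP := esym A0; rewrite /A /dot psumr_eq0 => [/allP/(_ i)|j _].
    by rewrite mem_index_enum => /(_ isT).
  by rewrite -expr2 sqr_ge0.
suff -> : C = 0 by rewrite -A0 mul0r expr0n.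
by apply: big1 => i _; rewrite u0 mul0r.
Qed.

(** The Frobenius norm serves as [K], by Cauchy-Schwarz on each row. This makes the supremum in
    [spectral_norm] one of a bounded set, hence a genuine upper bound. *)
Lemma norm2_mulmx_bound (R : realType) (d : nat) (A : 'M[R]_d) :
  exists K, forall v, norm2 v <= 1 -> norm2 (A *m v) <= K.
Proof.
exists (Num.sqrt (\sum_i norm2 (row i A)^T ^+ 2)) => v v1.
rewrite ler_wsqrtr//; apply: ler_sum => i _.
rewrite -ler_sqrt ?sqr_ge0// !sqrtr_sqr (ger0_norm (norm2_ge0 _)).
have -> : (A *m v) i 0 = dot (row i A)^T v.
  by rewrite mxE; apply: eq_bigr => j _; rewrite !mxE.
rewrite (le_trans (dot_le_norm2M _ _))//.
by rewrite ler_piMr ?norm2_ge0.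
Qed.

Lemma quadratic_form_le_spectral_norm (R : realType) (d : nat)
    (A : 'M[R]_d) (p : 'cV[R]_d) :
  norm2 p = 1 -> `|dot p (A *m p)| <= spectral_norm A.
Proof.
move=> p1; rewrite (le_trans (dot_le_norm2M _ _))// p1 mul1r.
have [K bK] := norm2_mulmx_bound A.
apply: ub_le_sup; last by exists p => //=; rewrite p1.
by exists K => _ [v /= v1 <-]; exact: bK.
Qed.

(** * Taylor upper bounds for functions of one real variable *)

Lemma ge0_derive_le (R : realType) (h h' : R -> R) (t : R) :
  (forall s, is_derive (s : R) (1 : R) h (h' s)) -> (forall s, 0 <= s -> 0 <= h' s) ->
  0 <= t -> h 0 <= h t.
Proof.
move=> dh h'0 t0.
have derh s : derivable h s 1 by case: (dh s).
apply: (@ger0_derive1_le_cc R h 0 t) => //.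
- move=> s; rewrite in_itv/= => /andP[s0 _].
  by rewrite derive1E (@derive_val _ _ _ _ _ _ _ (dh s)) h'0 1?ltW.
- by apply: derivable_within_continuous.
- by rewrite in_itv/= lexx.
- by rewrite in_itv/= t0 lexx.
Qed.

(** The majorant minus [h] has a nonnegative derivative on [0 <= s], so no integral remainder is
    needed. *)
Lemma le_linear_growth (R : realType) (h h' : R -> R) (K t : R) :
  (forall s, is_derive (s : R) (1 : R) h (h' s)) ->
  (forall s, 0 <= s -> h' s <= h' 0 + K * s) ->
  0 <= t -> h t <= h 0 + h' 0 * t + K / 2 * t ^+ 2.
Proof.
move=> dh h'K t0.
pose g s := h' 0 * s + K / 2 * s ^+ 2 - h s.
have dg s : is_derive (s : R) (1 : R) g (h' 0 + K * s - h' s).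
  apply: is_derive_eq; by rewrite /GRing.scale/=; field.
have := ge0_derive_le dg _ t0.
rewrite /g !mulr0 expr0n/= mulr0 => gt.
have {gt} : 0 + 0 - h 0 <= h' 0 * t + K / 2 * t ^+ 2 - h t.
  by apply: gt => s s0; rewrite subr_ge0 h'K.
lra.
Qed.

(** Same argument one order higher: the derivative of the majorant dominates [h'] by the previous
    bound applied to [h']. *)
Lemma le_quadratic_growth (R : realType) (h h' h'' : R -> R) (K t : R) :
  (forall s, is_derive (s : R) (1 : R) h (h' s)) ->
  (forall s, is_derive (s : R) (1 : R) h' (h'' s)) ->
  (forall s, 0 <= s -> h'' s <= h'' 0 + K * s) ->
  0 <= t ->
  h t <= h 0 + h' 0 * t + h'' 0 / 2 * t ^+ 2 + K / 6 * t ^+ 3.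
Proof.
move=> dh dh' h''K t0.
pose g s := h' 0 * s + h'' 0 / 2 * s ^+ 2 + K / 6 * s ^+ 3 - h s.
have dg s : is_derive (s : R) (1 : R) g (h' 0 + h'' 0 * s + K / 2 * s ^+ 2 - h' s).
  apply: is_derive_eq; by rewrite /GRing.scale/=; field.
have := @ge0_derive_le R g _ t dg _ t0.
rewrite /g !mulr0 !expr0n/= !mulr0 => /(_ _)/wrap[s s0|].
  by rewrite subr_ge0 (le_linear_growth dh').
lra.
Qed.

(** * Derivatives along lines and Taylor bounds in several variables *)

Lemma derive_gradient (R : realType) (d : nat) (f : 'cV[R]_d -> R)
    (x v : 'cV[R]_d) :
  differentiable f x -> 'D_v f x = dot (gradient f x) v.
Proof.
move=> dfx; rewrite deriveE// [in LHS](matrix_sum_delta v) linear_sum.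
apply: eq_bigr => i _; rewrite big_ord1 linearZ/= mxE deriveE//.
by rewrite /GRing.scale/= mulrC.
Qed.

Lemma is_derive_line (R : realType) (V W : normedModType R) (f : V -> W)
    (x v : V) (s : R) :
  differentiable f (x + s *: v) ->
  is_derive s (1 : R) (fun r : R => f (x + r *: v)) ('D_v f (x + s *: v)).
Proof.
move=> /diff_derivable dfx.
have E : (fun h : R => h^-1 *: (f (x + (h *: (1 : R) + s) *: v) - f (x + s *: v)))
    = (fun h => h^-1 *: (f (h *: v + (x + s *: v)) - f (x + s *: v))).
  apply/funext => h; congr (_ *: (f _ - _)).
  by rewrite scalerDl -[h *: 1]/(h * 1) mulr1 addrCA.
split; first by rewrite /derivable /= E; exact: dfx.
by rewrite /derive /= E.
Qed.

Lemma differentiable_gradient_coord (R : realType) (d : nat)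
    (f : 'cV[R]_d -> R) (x : 'cV[R]_d) (i : 'I_d) :
  differentiable (gradient f) x ->
  differentiable (fun y => gradient f y i 0) x.
Proof.
by move=> dgx; exact: (differentiable_comp dgx (differentiable_coord _ i 0)).
Qed.

(** Row [i] of the Hessian is the gradient of the [i]-th partial derivative, so each coordinate of
    the gradient is differentiated along the line and the results are summed with weights
    [v i 0]. *)
Lemma derive_dot_gradient (R : realType) (d : nat) (f : 'cV[R]_d -> R)
    (x v : 'cV[R]_d) (s : R) :
  differentiable (gradient f) (x + s *: v) ->
  is_derive s (1 : R) (fun r : R => dot (gradient f (x + r *: v)) v)
    (dot v (hessian f (x + s *: v) *m v)).
Proof.
move=> dg.
have -> : (fun r : R => dot (gradient f (x + r *: v)) v)
    = \sum_(i < d) (v i 0 \*: (fun r : R => gradient f (x + r *: v) i 0)).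
  by apply/funext => r; rewrite fct_sumE; apply: eq_bigr => i _; rewrite mulrC.
apply: is_derive_eq.
  apply: is_derive_sum => i; apply: is_deriveZ.
  apply: (is_derive_line (f := fun y => gradient f y i 0)).
  exact: differentiable_gradient_coord.
apply: eq_bigr => i _; rewrite derive_gradient; last first.
  exact: differentiable_gradient_coord.
congr (_ * _); rewrite mxE; apply: eq_bigr => j _.
by rewrite !mxE.
Qed.

(** Descent lemma: on the line through [x] with direction [v], the slope of [f] grows at rate at
    most [L * norm2 v ^+ 2]; the bound is read off at time 1. *)
Lemma gradient_step_bound (R : realType) (d : nat) (f : 'cV[R]_d -> R) (L : R)
    (x v : 'cV[R]_d) :
  (forall y, differentiable f y) -> lipschitz_gradient L f ->
  f (x + v) <= f x + dot (gradient f x) v + L / 2 * norm2 v ^+ 2.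
Proof.
move=> df lip.
have dh s : is_derive s (1 : R) (fun r : R => f (x + r *: v))
    (dot (gradient f (x + s *: v)) v).
  by rewrite -derive_gradient//; exact: is_derive_line.
have := @le_linear_growth R _ _ (L * norm2 v ^+ 2) 1 dh.
rewrite !scale0r !addr0 scale1r expr1n !mulr1 mulrAC; apply; last exact: ler01.
move=> s s0; rewrite -lerBlDl -dotBl.
rewrite (le_trans (ler_norm _))// (le_trans (dot_le_norm2M _ _))//.
rewrite expr2 mulrA mulrAC ler_wpM2r ?norm2_ge0// (le_trans (lip _ _))//.
by rewrite addrAC subrr add0r norm2Z ger0_norm// mulrA mulrAC.
Qed.

(** Cubic upper bound: for a unit vector [p], the second derivative along the line is a quadratic
    form in the Hessian, and it grows at rate at most [M]. *)
Lemma curvature_step_bound (R : realType) (d : nat) (f : 'cV[R]_d -> R) (M t : R)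
    (x p : 'cV[R]_d) :
  twice_differentiable f -> lipschitz_hessian M f -> norm2 p = 1 -> 0 <= t ->
  f (x + t *: p) <= f x + dot (gradient f x) p * t +
    dot p (hessian f x *m p) / 2 * t ^+ 2 + M / 6 * t ^+ 3.
Proof.
move=> [df dg] lip p1 t0.
have dh s : is_derive s (1 : R) (fun r : R => f (x + r *: p))
    (dot (gradient f (x + s *: p)) p).
  by rewrite -derive_gradient//; exact: is_derive_line.
have dh' s := derive_dot_gradient (dg (x + s *: p)).
have := @le_quadratic_growth R _ _ _ M t dh dh'.
rewrite !scale0r !addr0; apply=> // s s0; rewrite -lerBlDl.
rewrite -dotBr -mulmxBl.
rewrite (le_trans (ler_norm _))// (le_trans (quadratic_form_le_spectral_norm _ p1))//.
rewrite (le_trans (lip _ _))//.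
by rewrite addrAC subrr add0r norm2Z ger0_norm// p1 mulr1.
Qed.

(** * Measurability of continuous functions of random vectors *)

(** Writes an open set as a countable union of max-norm balls with rational centres, so that
    measurability of a random vector need only be known coordinate by coordinate. *)
Lemma open_cV_rational (R : realType) (d : nat) (U : set 'cV[R]_d) :
  open U ->
  U = \bigcup_(b : 'cV[rat]_d * nat) [set x |
    ball (map_mx ratr b.1 : 'cV[R]_d) b.2.+1%:R^-1 `<=` U /\
    ball (map_mx ratr b.1 : 'cV[R]_d) b.2.+1%:R^-1 x].
Proof.
move=> oU; apply/seteqP; split=> [x Ux|x [b _ [/(_ x) bU bx]]]; last exact: bU.
have /nbhs_ballP[e /= e0 eU] := open_nbhs_nbhs (conj oU Ux).
(* A radius below [e / 2] keeps any ball of that radius containing [x] inside the [e]-ball around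
   [x]. *)
have [n en] : exists n, n.+1%:R^-1 < e / 2 :> R.
  have [n _ /(_ n (leqnn n))] := near_infty_natSinv_lt (PosNum (divr_gt0 e0 (ltr0n R 2))).
  by exists n.
have r0 : 0 < n.+1%:R^-1 :> R by [].
have near_rat i : exists q : rat, `|ratr q - x i 0| < n.+1%:R^-1.
  have [|q] := @rat_in_itvoo R (x i 0 - n.+1%:R^-1) (x i 0 + n.+1%:R^-1).
    by rewrite ltrD2l (lt_trans _ r0)// oppr_lt0.
  by rewrite in_itv/= => qx; exists q; rewrite ltr_distl.
pose q : 'cV[rat]_d := \col_i sval (cid (near_rat i)).
have qx : ball (map_mx ratr q : 'cV[R]_d) n.+1%:R^-1 x.
  split=> // i j; rewrite (ord1 j) !mxE.
  exact: (svalP (cid (near_rat i))).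
exists (q, n) => //; split=> // y /= qy; apply: eU.
have := ball_triangle (ball_sym qx) qy.
by apply: le_ball; rewrite (le_trans (lerD (ltW en) (ltW en)))// -splitr.
Qed.

Lemma measurable_fun_comp_continuous (R : realType) (dsp : measure_display)
    (T : measurableType dsp) (d : nat) (X : T -> 'cV[R]_d) (h : 'cV[R]_d -> R) :
  (forall i, measurable_fun setT (fun w => X w i 0)) -> continuous h ->
  measurable_fun setT (h \o X).
Proof.
move=> mX ch; apply: (measurability _ (RGenOpens.measurableE R)).
move=> _ [_ [a [b ->]] <-]; rewrite setTI comp_preimage.
have oU : open (h @^-1` `]a, b[) by move/continuousP : ch; apply; exact: interval_open.
rewrite (open_cV_rational oU).
rewrite preimage_bigcup; apply: countable_bigcupT_measurable => // -[q n].
have [qU|nqU] := pselect (ball (map_mx ratr q : 'cV[R]_d) n.+1%:R^-1 `<=` h @^-1` `]a, b[); last first.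
  rewrite (_ : _ @^-1` _ = set0); first exact: measurable0.
  by apply/seteqP; split=> // x [].
(* A max-norm ball is a finite intersection of coordinate conditions, expressed here as the
   complement of a finite union. *)
rewrite (_ : _ @^-1` _ = ~` \bigcup_(i : 'I_d)
    ~` [set w | `|ratr (q i 0) - X w i 0| < n.+1%:R^-1]).
  apply/measurableC/fin_bigcup_measurable => [|i _]; first exact: finite_finset.
  apply: measurableC.
  have m : measurable_fun setT (fun w => ratr (q i 0) - X w i 0).
    by apply: measurable_funB => //; exact: measurable_cst.
  rewrite (_ : mkset _ = (fun w => ratr (q i 0) - X w i 0) @^-1`
      ball (0 : R) n.+1%:R^-1).
    by rewrite -[X in measurable X]setTI; exact: (m measurableT _ (measurable_ball _ _)).
  by apply/funext => w; rewrite /preimage /ball /= sub0r normrN.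
apply/seteqP; split=> [w [_ [_ qw]] [i _]|w qw].
  apply; have := qw i 0; rewrite mxE; exact.
split=> //; split=> // i j; rewrite (ord1 j) mxE.
by apply: contrapT => nb; apply: qw; exists i.
Qed.

Lemma measurable_fun_dot (R : realType) (dsp : measure_display)
    (T : measurableType dsp) (d : nat) (X Y : T -> 'cV[R]_d) :
  (forall i, measurable_fun setT (fun w => X w i 0)) ->
  (forall i, measurable_fun setT (fun w => Y w i 0)) ->
  measurable_fun setT (fun w => dot (X w) (Y w)).
Proof. by move=> mX mY; apply: measurable_sum => i; exact: measurable_funM. Qed.

Lemma measurable_le_set (R : realType) (dsp : measure_display)
    (T : measurableType dsp) (f g : T -> R) :
  measurable_fun setT f -> measurable_fun setT g ->
  measurable [set w | f w <= g w].
Proof.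
move=> mf mg; have := measurable_fun_ler mf mg.
by move=> /(_ measurableT [set true] I); rewrite setTI.
Qed.

(** * Generated sigma-algebras and integration against an independent fair sign *)

(** The carrier is still [T]; only its measurable structure changes, so that measurability with
    respect to [sigma_generated X] becomes an ordinary [measurable_fun] statement. *)
Definition generated_type {dsp : measure_display} {T : measurableType dsp}
    {R : realType} (X : set (T -> R)) :=
  g_sigma_algebraType
    (\bigcup_(h in X) preimage_set_system [set: T] h measurable).

Lemma measurable_fun_generator (dsp : measure_display) (T : measurableType dsp)
    (R : realType) (X : set (T -> R)) (h : T -> R) :
  X h -> measurable_fun [set: generated_type X] h.
Proof.
move=> Xh _ B mB; apply: sub_sigma_algebra; exists h => //.
by exists B.
Qed.

Lemma sigma_generated_sub (dsp : measure_display) (T : measurableType dsp)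
    (R : realType) (X : set (T -> R)) :
  (forall h, X h -> measurable_fun [set: T] h) ->
  sigma_generated X `<=` measurable.
Proof.
move=> mX; apply: smallest_sub; first exact: sigma_algebra_measurable.
by move=> A [h Xh [B mB <-]]; exact: mX.
Qed.

Lemma measurable_fun_generated (dsp : measure_display) (T : measurableType dsp)
    (R : realType) (X : set (T -> R)) (h : T -> R) :
  (forall g, X g -> measurable_fun [set: T] g) ->
  measurable_fun [set: generated_type X] h -> measurable_fun [set: T] h.
Proof.
move=> mX mh _ B mB; apply: (sigma_generated_sub mX).
exact: (mh measurableT).
Qed.

(* Both sides are the integral of [`|y|] against the law of [W * \1_S], resp.
   [W * \1_S'], which avoids integrating against restricted measures. *)
Lemma integral_eq_of_distribution (dsp : measure_display)
    (T : measurableType dsp) (R : realType) (P : probability T R)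
    (S S' : set T) (W : T -> R) :
  measurable S -> measurable S' -> P S = P S' ->
  measurable_fun setT W -> (forall w, 0 <= W w) ->
  (forall B, measurable B -> P (W @^-1` B `&` S) = P (W @^-1` B `&` S')) ->
  (\int[P]_(w in S) (W w)%:E = \int[P]_(w in S') (W w)%:E)%E.
Proof.
move=> mS mS' SS' mW W0 WSS'.
have mW1 A : measurable A -> measurable_fun setT (fun w => W w * \1_A w).
  by move=> mA; apply: measurable_funM => //; exact: measurable_indic.
have toR A (mA : measurable A) : (\int[P]_(w in A) (W w)%:E
    = \int[pushforward P (fun w => (W w * \1_A w)%R)]_y (`|y|%R)%:E)%E.
  rewrite (ge0_integral_pushforward (mW1 _ mA))//=; last first.
    by apply/measurable_EFinP; exact: normr_measurable.
  rewrite integral_mkcond; apply: eq_integral => w _.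
  rewrite patchE /= indicE; case: (w \in A); rewrite ?mulr1 ?mulr0 ?normr0//.
  by rewrite ger0_norm.
rewrite !toR//; apply: eq_measure_integral; [exact: mW1|exact: mW1|].
move=> mWS' mWS B mB _.
(* Off [A] the function [W * \1_A] vanishes, so the preimage of [B] contains the complement of [A]
   exactly when [0] lies in [B]. *)
pose b := (0 : R) \in B.
have split A : measurable A -> P ((fun w => W w * \1_A w) @^-1` B)
    = (P (W @^-1` B `&` A) + (if b then 1 - P A else 0))%E.
  move=> mA.
  have mWB : measurable (W @^-1` B) by rewrite -[X in measurable X]setTI; exact: mW.
  have mB0 : measurable (if b then ~` A else set0).
    by case: ifP => _ //; exact: measurableC.
  rewrite (_ : _ @^-1` B = (W @^-1` B `&` A) `|` (if b then ~` A else set0)).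
    have mWBA : measurable (W @^-1` B `&` A) by exact: measurableI.
    rewrite measureU//.
      case: (b); last by rewrite measure0.
      by congr (_ + _)%E; exact: probability_setC.
    by case: ifP => _; rewrite ?setI0// -setIA setICr setI0.
  apply/seteqP; split=> w /=.
    rewrite indicE; have [wA|wA] := boolP (w \in A).
      by rewrite mulr1 => BW; left; split=> //; rewrite inE in wA.
    rewrite mulr0 => B0; right; rewrite /b (mem_set B0)/=.
    by move: wA; rewrite notin_setE.
  move=> [[BW Aw]|]; first by rewrite indicE (mem_set Aw) mulr1.
  rewrite /b; case: ifPn => // B0 /= nA; rewrite indicE (memNset nA) mulr0.
  by rewrite inE in B0.
rewrite [LHS](split S mS) [RHS](split S' mS') SS'.
by congr (_ + _)%E; exact: WSS'.
Qed.

(** The shift by [C] keeps all integrands nonnegative. By independence, the integral of [C + Z] over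
    the heads part of [B] equals that over the tails part, where it adds to [C - Z] to give [2 * C]
    on an event of probability [P B / 2]. *)
Lemma integral_fair_coin (dsp : measure_display) (T : measurableType dsp)
    (R : realType) (P : probability T R) (X : set (T -> R)) (s Z : T -> R)
    (B : set T) (C : R) :
  (forall h, X h -> measurable_fun setT h) -> measurable_fun setT s ->
  (forall w, s w = 1 \/ s w = -1) ->
  P [set w | s w = 1] = (1 / 2)%:E -> P [set w | s w = -1] = (1 / 2)%:E ->
  independent P (sigma_generated X) (sigma_generated [set s]) ->
  measurable_fun [set: generated_type X] Z ->
  sigma_generated X B -> (forall w, `|Z w| <= C) ->
  (\int[P]_(w in B) (C + s w * Z w)%:E = C%:E * P B)%E.
Proof.
move=> mX ms s1 Ps Ps' ind mZ FB ZC.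
have C0 w : 0 <= C + Z w by have := ZC w; rewrite ler_norml => /andP[]; lra.
have C0' w : 0 <= C - Z w by have := ZC w; rewrite ler_norml => /andP[]; lra.
have mB : measurable B by exact: (sigma_generated_sub mX).
have mZT := measurable_fun_generated mX mZ.
have Fs c : sigma_generated [set s] [set w | s w = c].
  apply: sub_sigma_algebra; exists s => //; exists [set c] => //.
  by rewrite setTI.
have mSc c : measurable [set w | s w = c].
  by apply: (sigma_generated_sub _ (Fs c)) => h ->.
pose S := [set w | s w = 1]; pose S' := [set w | s w = -1].
have mS : measurable S := mSc 1.
have mS' : measurable S' := mSc (-1).
have PSS' : P S = P S' by rewrite /S /S' Ps Ps'.
have SS' : S `|` S' = setT.
  by apply/seteqP; split=> // w _; case: (s1 w); [left|right].
have dSS' : [disjoint (B `&` S) & (B `&` S')].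
  apply/eqP/seteqP; split=> // w [[_ +] [_]]; rewrite /S /S' /= => -> /eqP.
  by rewrite gt_eqF// (lt_trans (ltrN10 R)).
(* Absorbing [B] into the integrand leaves a function measurable for [X] alone, to which
   independence from the sign applies. *)
pose W w := (C + Z w) * \1_B w.
have mW : measurable_fun [set: generated_type X] W.
  apply: measurable_funM; first by apply: measurable_funD => //; exact: measurable_cst.
  exact: measurable_indic.
have W0 w : 0 <= W w by rewrite mulr_ge0.
have swap : (\int[P]_(w in S) (W w)%:E = \int[P]_(w in S') (W w)%:E)%E.
  apply: integral_eq_of_distribution => //.
    exact: (measurable_fun_generated mX).
  move=> D mD; have FW : sigma_generated X (W @^-1` D).
    by have := mW measurableT D mD; rewrite setTI.
  by rewrite (ind _ _ FW (Fs 1)) (ind _ _ FW (Fs (-1))); congr (_ * _)%E.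
have toS A : measurable A ->
    (\int[P]_(w in A) (W w)%:E = \int[P]_(w in B `&` A) (C + Z w)%:E)%E.
  move=> mA; rewrite integral_mkcond [RHS]integral_mkcond.
  apply: eq_integral => w _; rewrite !patchE in_setI /W indicE.
  by case: (w \in B); case: (w \in A); rewrite ?mulr1 ?mulr0.
have mI A : measurable A -> measurable (B `&` A) by move=> ?; exact: measurableI.
have mf (g : T -> R) A : measurable_fun setT g -> measurable_fun A (EFin \o g).
  by move=> mg; apply: measurable_funTS; exact/measurable_EFinP.
have mp : measurable_fun setT (fun w => C + Z w).
  by apply: measurable_funD => //; exact: measurable_cst.
have mm : measurable_fun setT (fun w => C - Z w).
  by apply: measurable_funB => //; exact: measurable_cst.
have BE : B = (B `&` S) `|` (B `&` S') by rewrite -setIUr SS' setIT.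
rewrite {1}BE ge0_integral_setU//=; first last.
- move=> w _; rewrite lee_fin.
  by case: (s1 w) => ->; rewrite ?mul1r ?mulN1r.
- apply: (mf (fun w => C + s w * Z w)).
  by apply: measurable_funD; [exact: measurable_cst|exact: measurable_funM].
- exact: mI.
- exact: mI.
have -> : (\int[P]_(w in B `&` S) (C + s w * Z w)%:E
    = \int[P]_(w in B `&` S') (C + Z w)%:E)%E.
  rewrite -!toS// -swap toS//; apply: eq_integral => w.
  by rewrite inE => -[_ /= ->]; rewrite mul1r.
have -> : (\int[P]_(w in B `&` S') (C + s w * Z w)%:E
    = \int[P]_(w in B `&` S') (C - Z w)%:E)%E.
  by apply: eq_integral => w; rewrite inE => -[_ /= ->]; rewrite mulN1r.
rewrite -(ge0_integralD P (mI _ mS') (fun w _ => C0 w : 0 <= (C + Z w)%:E)%E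
  (mf _ _ mp) (fun w _ => C0' w : 0 <= (C - Z w)%:E)%E (mf _ _ mm)).
rewrite (eq_integral (cst (2 * C)%:E)) => [|w _]; last first.
  by rewrite -EFinD; congr EFin; ring.
rewrite (integral_cst P (mI _ mS')).
rewrite [X in (_ * X)%E](ind B S' FB (Fs (-1))).
rewrite Ps' [X in (_ * X)%E]muleC muleA -EFinM.
by congr (_%:E * _)%E; field.
Qed.

(** * Deterministic decrease for each kind of step *)

(** The relative error gives [dot (gradient f x) g >= 2 / 3 * norm2 g ^+ 2]; the descent lemma costs
    [1 / 2], and [2 / 3 - 1 / 2 = 1 / 6]. *)
Lemma gradient_step_decrease (R : realType) (d : nat) (f : 'cV[R]_d -> R)
    (L eps : R) (x g : 'cV[R]_d) :
  0 < L -> (forall y, differentiable f y) -> lipschitz_gradient L f ->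
  0 < eps < norm2 g ->
  norm2 (g - gradient f x) <= 1 / 3 * Num.max eps (norm2 g) ->
  f (x - L^-1 *: g) + eps ^+ 2 / (6 * L) <= f x.
Proof.
move=> L0 df lip /andP[eps0 epsg]; rewrite max_r ?(ltW epsg)// => gerr.
have := gradient_step_bound x (- L^-1 *: g) df lip.
rewrite dotZr norm2Z normrN gtr0_norm ?invr_gt0// scaleNr exprMn.
have inner : 2 / 3 * norm2 g ^+ 2 <= dot (gradient f x) g.
  have -> : dot (gradient f x) g = norm2 g ^+ 2 - dot (g - gradient f x) g.
    by rewrite dotBl sqr_norm2; ring.
  have : dot (g - gradient f x) g <= 1 / 3 * norm2 g ^+ 2.
    rewrite (le_trans (ler_norm _))// (le_trans (dot_le_norm2M _ _))//.
    by rewrite expr2 mulrA ler_wpM2r ?norm2_ge0.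
  lra.
have : L^-1 * (2 / 3 * norm2 g ^+ 2) <= L^-1 * dot (gradient f x) g.
  by rewrite ler_pM2l ?invr_gt0.
have : L^-1 * (eps ^+ 2 / 6) <= L^-1 * (norm2 g ^+ 2 / 6).
  rewrite ler_pM2l ?invr_gt0// ler_pM2r ?invr_gt0//.
  by rewrite ler_sqr ?nnegrE ?norm2_ge0 ?ltW.
have -> : eps ^+ 2 / (6 * L) = L^-1 * (eps ^+ 2 / 6) by field; rewrite gt_eqF.
have -> : L / 2 * (L^-1 ^+ 2 * norm2 g ^+ 2) = L^-1 * (norm2 g ^+ 2 / 2).
  by field; rewrite gt_eqF.
lra.
Qed.

(** The Hessian error is at most [2 / 9 * a], so the true curvature along [p] is at most
    [- (7 / 9 * a)]. In units of [a ^+ 3 / M ^+ 2] the quadratic term is at most [- 14 / 9] and the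
    cubic one is [12 / 9], leaving [- 2 / 9]. The sign [s] survives only in the first-order term. *)
Lemma curvature_step_decrease (R : realType) (d : nat) (f : 'cV[R]_d -> R)
    (M eps a s : R) (x p : 'cV[R]_d) (H : 'M[R]_d) :
  0 < M -> twice_differentiable f -> lipschitz_hessian M f -> norm2 p = 1 ->
  spectral_norm (H - hessian f x) <= 2 / 9 * eps -> s = 1 \/ s = -1 ->
  0 < eps <= a -> dot p (H *m p) <= - a ->
  f (x + (2 * a / M * s) *: p) + 2 * eps ^+ 3 / (9 * M ^+ 2)
    <= f x + s * (2 * a / M * dot (gradient f x) p).
Proof.
move=> M0 df lip p1 Herr s1 /andP[eps0 epsa] pHp.
have a0 : 0 < a by exact: lt_le_trans epsa.
have ss : s * s = 1 by case: s1 => ->; rewrite ?mulr1// mulrNN mulr1.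
have sp1 : norm2 (s *: p) = 1.
  by rewrite norm2Z p1 mulr1; case: s1 => ->; rewrite ?normrN normr1.
have t0 : 0 <= 2 * a / M by rewrite divr_ge0 ?mulr_ge0 ?ltW.
have := curvature_step_bound x df lip sp1 t0.
rewrite scalerA !dotZr -scalemxAr.
have -> : dot (s *: p) (s *: (hessian f x *m p)) = dot p (hessian f x *m p).
  rewrite -[RHS]mul1r -ss /dot mulr_sumr; apply: eq_bigr => i _.
  by rewrite !mxE; ring.
set q := dot p _; have q_le : q <= - (7 / 9 * a).
  have := quadratic_form_le_spectral_norm (H - hessian f x) p1.
  rewrite mulmxBl dotBr -/q distrC => /(le_trans (ler_norm _)).
  lra.
have : q * (2 * (a / M) ^+ 2) <= - (7 / 9 * a) * (2 * (a / M) ^+ 2).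
  by rewrite ler_wpM2r// mulr_ge0// sqr_ge0.
have -> : q / 2 * (2 * a / M) ^+ 2 = q * (2 * (a / M) ^+ 2).
  by field; rewrite gt_eqF.
have -> : M / 6 * (2 * a / M) ^+ 3 = 4 / 3 * (a * (a / M) ^+ 2).
  by field; rewrite gt_eqF.
have -> : 2 * eps ^+ 3 / (9 * M ^+ 2) = 2 / 9 * (eps ^+ 3 / M ^+ 2).
  by field; rewrite gt_eqF.
have : eps ^+ 3 / M ^+ 2 <= a * (a / M) ^+ 2.
  have -> : a * (a / M) ^+ 2 = a ^+ 3 / M ^+ 2 by field; rewrite gt_eqF.
  by rewrite ler_pM2r ?invr_gt0 ?exprn_gt0// ler_pXn2r// nnegrE ltW.
set c := a * (a / M) ^+ 2.
have -> : - (7 / 9 * a) * (2 * (a / M) ^+ 2) = - (14 / 9 * c) by rewrite /c; ring.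
lra.
Qed.

(** * Decrease in expectation and telescoping *)

(** The finite quantity [C * P B], which is the integral of [C + U], is added to both sides; the
    claim then follows from a pointwise comparison of nonnegative functions, without integrability
    of [V]. *)
Lemma expected_decrease (dsp : measure_display) (T : measurableType dsp)
    (R : realType) (P : probability T R) (B : set T) (V V' U : T -> R) (C r : R) :
  measurable B -> measurable_fun setT V -> measurable_fun setT V' ->
  measurable_fun setT U ->
  (forall w, 0 <= V w) -> (forall w, 0 <= V' w) -> 0 <= r ->
  (forall w, `|U w| <= C) ->
  (\int[P]_(w in B) (C + U w)%:E = C%:E * P B)%E ->
  (forall w, B w -> V' w + r <= V w + U w) ->
  (\int[P]_(w in B) (V' w)%:E + r%:E * P B <= \int[P]_(w in B) (V w)%:E)%E.
Proof.
move=> mB mV mV' mU V0 V'0 r0 UC intU dec.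
have C0 : 0 <= C by rewrite (le_trans _ (UC point)).
have CU w : 0 <= C + U w by have := UC w; rewrite ler_norml => /andP[]; lra.
have mf (g : T -> R) : measurable_fun setT g -> measurable_fun B (EFin \o g).
  by move=> mg; apply: measurable_funTS; exact/measurable_EFinP.
have mCU : measurable_fun setT (fun w => C + U w).
  by apply: measurable_funD => //; exact: measurable_cst.
have PBfin : (C%:E * P B)%E \is a fin_num.
  by rewrite fin_numM// fin_num_measure.
rewrite -(leeD2rE _ _ PBfin) -intU -addeA.
have -> : (r%:E * P B + \int[P]_(w in B) (C + U w)%:E
    = \int[P]_(w in B) (r + C)%:E)%E.
  rewrite intU -ge0_muleDl ?lee_fin//.
  exact: (esym (integral_cst P mB (r + C)%:E)).
rewrite -(ge0_integralD P mB (fun w _ => V'0 w : 0 <= (V' w)%:E)%E (mf _ mV')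
  (fun w _ => addr_ge0 r0 C0 : 0 <= (r + C)%:E)%E (mf _ (measurable_cst _))).
rewrite -(ge0_integralD P mB (fun w _ => V0 w : 0 <= (V w)%:E)%E (mf _ mV)
  (fun w _ => CU w : 0 <= (C + U w)%:E)%E (mf _ mCU)).
apply: ge0_le_integral => //.
- by move=> w _; rewrite -EFinD lee_fin !addr_ge0.
- apply: (mf (fun w => V' w + (r + C))).
  by apply: measurable_funD => //; exact: measurable_cst.
- apply: (mf (fun w => V w + (C + U w))); exact: measurable_funD.
- by move=> w Bw; rewrite -!EFinD lee_fin; have := dec w Bw; lra.
Qed.

(** Telescoping: [a n] plus [r] times the first [n] terms of [p] never exceeds [a 0]. *)
Lemma nneseries_le_of_decrease (R : realType) (a p : nat -> \bar R) (r : R) :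
  0 < r -> (forall k, 0 <= a k)%E -> (forall k, 0 <= p k)%E ->
  (forall k, a k.+1 + r%:E * p k <= a k)%E ->
  (\sum_(k <oo) p k <= r^-1%:E * a 0%N)%E.
Proof.
move=> r0 a0 p0 dec.
have partial n : (a n + r%:E * \sum_(0 <= k < n) p k <= a 0%N)%E.
  elim: n => [|n]; first by rewrite big_geq// mule0 adde0.
  apply: le_trans; rewrite big_nat_recr//= ge0_muleDr ?sume_ge0//.
  by rewrite addeCA [leRHS]addeC leeD2l.
apply: lime_le; first exact: is_cvg_nneseries.
apply: nearW => n.
rewrite -[leLHS]mul1e -(@mulVf _ r) ?gt_eqF// EFinM -muleA.
rewrite lee_pmul2l ?lte_fin ?invr_gt0//.
by rewrite (le_trans _ (partial n))// leeDr.
Qed.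

(** * The termination time and the events known before each draw *)

(** Tail formula: [reached] at [k.+1] is the event that termination occurs after iteration [k], so
    its indicators count the iterations before termination. *)
Lemma termination_time_series (dsp : measure_display) (T : measurableType dsp)
    (R : realType) (d : nat) (E : execution T R d) (eps_g eps_H : R) (w : T) :
  termination_time E eps_g eps_H w =
  (\sum_(k <oo) (\1_[set w | reached E eps_g eps_H k.+1 w] w)%:E)%E.
Proof.
have ind0 k : (0 <= (\1_[set w | reached E eps_g eps_H k.+1 w] w)%:E :> \bar R)%E.
  by rewrite lee_fin indicE ler0n.
have ind1 k : reached E eps_g eps_H k.+1 w ->
    \1_[set w | reached E eps_g eps_H k.+1 w] w = 1 :> R.
  by move=> rk; rewrite indicE mem_set.
have [[k sk]|nostop] := pselect (exists k, stops_at E eps_g eps_H k w).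
  have ex : exists k, `[< stops_at E eps_g eps_H k w >] by exists k; exact/asboolP.
  (* At the first stopping index [m], the indicators switch from 1 to 0. *)
  have [m /asboolP sm mmin] := ex_minnP ex.
  have rm j : (j < m)%N -> reached E eps_g eps_H j.+1 w.
    move=> jm i ij /asboolP/mmin; rewrite leqNgt (leq_ltn_trans _ jm)//.
  rewrite (nneseries_split 0 m)// eseries0 ?adde0 => [|j mj _]; last first.
    by rewrite indicE memNset//= => /(_ m); rewrite ltnS => /(_ mj).
  rewrite big_nat (eq_bigr (fun=> 1%:E)) => [|j /andP[_ jm]]; last first.
    by rewrite ind1//; exact: rm.
  rewrite -big_nat sumEFin sumr_const_nat subn0 add0n.
  apply/eqP; rewrite eq_le; apply/andP; split.
    by apply: ereal_inf_lbound; exists m.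
  apply: le_ereal_inf_tmp => _ [j /= sj <-]; rewrite lee_fin ler_nat.
  by apply: mmin; exact/asboolP.
have -> : termination_time E eps_g eps_H w = +oo%E.
  rewrite /termination_time (_ : [set _ | _ in _] = set0) ?ereal_inf0//.
  by apply/seteqP; split=> // t [k sk _]; apply: nostop; exists k.
apply/esym/eqyP => A A0.
(* Without a stop every term is 1, and [(Num.truncn A).+1] of them already exceed [A]. *)
apply: le_trans (nneseries_lim_ge (Num.truncn A).+1 (fun k _ _ => ind0 k)).
rewrite (eq_bigr (fun=> 1%:E)) => [|j _]; last first.
  by rewrite ind1// => i _ si; apply: nostop; exists i.
rewrite sumEFin sumr_const_nat subn0 lee_fin ltW//.
exact: truncnS_gt.
Qed.

(** Squaring turns the condition into a polynomial inequality in the entries of the gradient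
    estimate. *)
Lemma measurable_small_gradient (dsp : measure_display) (T : measurableType dsp)
    (R : realType) (d : nat) (E : execution T R d) (eps_g : R) (k i : nat) :
  0 <= eps_g -> (i <= k)%N ->
  measurable ([set w | norm2 (grad_est E i w) <= eps_g] :
    set (generated_type (history E k))).
Proof.
move=> eps0 ik.
rewrite (_ : mkset _ =
    [set w | dot (grad_est E i w) (grad_est E i w) <= eps_g ^+ 2]); last first.
  apply/funext => w /=; congr is_true.
  by rewrite -sqr_norm2 ler_sqr// nnegrE norm2_ge0.
apply: (measurable_le_set (T := generated_type (history E k))) => //.
by apply: measurable_fun_dot => j; apply: measurable_fun_generator; exact: hist_grad.
Qed.

(** Being reached at [k.+1] involves the stopping tests at iterations up to [k] only, all of them
    decided before the draw at iteration [k]. *)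
Lemma measurable_reached (dsp : measure_display) (T : measurableType dsp)
    (R : realType) (d : nat) (E : execution T R d) (eps_g eps_H : R) (k : nat) :
  0 <= eps_g ->
  measurable ([set w | reached E eps_g eps_H k.+1 w] :
    set (generated_type (history E k))).
Proof.
move=> eps0; rewrite (_ : mkset _ =
    ~` \bigcup_(i in [set i | (i <= k)%N]) [set w | stops_at E eps_g eps_H i w]).
  apply: measurableC; apply: bigcup_measurable => i /= ik.
  apply: measurableI; first exact: measurable_small_gradient.
  apply: (measurable_le_set (T := generated_type (history E k))) => //.
  by apply: measurable_fun_generator; exact: hist_eigval.
apply/seteqP; split=> [w rw [i /= ik] si|w nsw i ik si].
  exact: (rw i).
by apply: nsw; exists i.
Qed.

Lemma eigval_dot (dsp : measure_display) (T : measurableType dsp)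
    (R : realType) (d : nat) (E : execution T R d) (k : nat) (w : T) :
  eigval E k w = dot (eigvec E k w) (hess_est E k w *m eigvec E k w).
Proof.
rewrite /eigval -mulmxA mxE; apply: eq_bigr => i _.
by rewrite mxE.
Qed.

(** * The increment and the decrease at each iteration of an execution *)

Lemma R_eps_gt0 (R : realType) (eps_g eps_H L M : R) :
  0 < eps_g -> 0 < eps_H -> 0 < L -> 0 < M -> 0 < R_eps eps_g eps_H L M.
Proof.
move=> g0 H0 L0 M0; rewrite lt_min.
by rewrite !divr_gt0 ?mulr_gt0 ?exprn_gt0.
Qed.

(* The martingale increment: the first-order change of [f] along a negative
   curvature step is [coin E k w * curvature_slope f M E eps_g eps_H k w]. *)
Definition curvature_slope {dsp : measure_display} {T : measurableType dsp}
    {R : realType} {d : nat} (f : 'cV[R]_d -> R) (M : R) (E : execution T R d)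
    (eps_g eps_H : R) (k : nat) (w : T) : R :=
  \1_[set w | reached E eps_g eps_H k.+1 w /\ norm2 (grad_est E k w) <= eps_g] w *
  (2 * curv_step E k w / M * dot (gradient f (iterate E k w)) (eigvec E k w)).

Lemma measurable_curvature_slope (dsp : measure_display)
    (T : measurableType dsp) (R : realType) (d : nat) (f : 'cV[R]_d -> R) (M : R)
    (E : execution T R d) (eps_g eps_H : R) (k : nat) :
  0 <= eps_g -> twice_differentiable f ->
  measurable_fun [set: generated_type (history E k)]
    (curvature_slope f M E eps_g eps_H k).
Proof.
move=> eps0 [_ dg]; apply: measurable_funM.
  apply: measurable_indic; apply: measurableI; first exact: measurable_reached.
  exact: measurable_small_gradient.
apply: measurable_funM.
  apply: measurable_funM; last exact: measurable_cst.
  apply: measurable_funM; first exact: measurable_cst.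
  by apply: measurable_fun_generator; exact: hist_step.
apply: measurable_fun_dot => i; last first.
  by apply: measurable_fun_generator; exact: hist_eigvec.
apply: (measurable_fun_comp_continuous (h := fun y => gradient f y i 0)).
  by move=> j; apply: measurable_fun_generator; exact: hist_iterate.
by move=> y; apply: differentiable_continuous; exact: differentiable_gradient_coord.
Qed.

Lemma reachedS (dsp : measure_display) (T : measurableType dsp)
    (R : realType) (d : nat) (E : execution T R d) (eps_g eps_H : R) (k : nat)
    (w : T) :
  reached E eps_g eps_H k.+1 w ->
  reached E eps_g eps_H k w /\ ~ stops_at E eps_g eps_H k w.
Proof. by move=> rw; split=> [i ik|]; apply: rw => //; exact: ltnW. Qed.

Lemma eigval_lt_of_reachedS (dsp : measure_display) (T : measurableType dsp)
    (R : realType) (d : nat) (E : execution T R d) (eps_g eps_H : R) (k : nat)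
    (w : T) :
  reached E eps_g eps_H k.+1 w -> norm2 (grad_est E k w) <= eps_g ->
  hessian_requested E eps_g eps_H k w /\ eigval E k w < - eps_H.
Proof.
move=> /reachedS[rk nstop] small; split=> //.
by rewrite ltNge; apply/negP => ?; apply: nstop.
Qed.

(** The indicator leaves only negative curvature steps. There the step parameter is at most [alpha],
    and the true gradient has norm at most [eps_g] plus the oracle error [eps_g / 3]. *)
Lemma curvature_slope_bound (dsp : measure_display)
    (T : measurableType dsp) (R : realType) (d : nat) (f : 'cV[R]_d -> R)
    (L M alpha : R) (x0 : 'cV[R]_d) (E : execution T R d) (eps_g eps_H : R)
    (k : nat) (w : T) :
  0 < M -> 0 < eps_g -> 0 < eps_H -> eps_H <= alpha ->
  runs_algorithm E eps_g eps_H L M alpha x0 ->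
  inexact_oracles E eps_g eps_H f ->
  `|curvature_slope f M E eps_g eps_H k w| <= 2 * alpha / M * (4 / 3 * eps_g).
Proof.
move=> M0 g0 H0 Ha hrun orac.
have bound0 : 0 <= 2 * alpha / M by rewrite divr_ge0 ?mulr_ge0 ?ltW// (lt_le_trans H0).
rewrite /curvature_slope indicE; case: (boolP (w \in _)) => [|_]; last first.
  by rewrite mul0r normr0 mulr_ge0// mulr_ge0// ltW.
rewrite inE mul1r => -[/= rw small].
have [req lam] := eigval_lt_of_reachedS rw small.
have [_ p1] := run_hessian_oracle hrun req.
have [/andP[ca]] := run_curvature_step hrun req lam.
rewrite le_min => /andP[ca' _] _.
have c0 : 0 <= 2 * curv_step E k w / M.
  by rewrite divr_ge0 ?mulr_ge0// ltW// (lt_le_trans H0).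
rewrite normrM (ger0_norm c0) ler_pM//.
  by rewrite ler_pM2r ?invr_gt0// ler_pM2l.
have := oracle_gradient orac req.1; rewrite max_l// => gerr.
have -> : dot (gradient f (iterate E k w)) (eigvec E k w) =
    dot (grad_est E k w) (eigvec E k w)
    - dot (grad_est E k w - gradient f (iterate E k w)) (eigvec E k w).
  by rewrite dotBl; ring.
rewrite (le_trans (ler_normB _ _))//.
have := dot_le_norm2M (grad_est E k w) (eigvec E k w).
have := dot_le_norm2M (grad_est E k w - gradient f (iterate E k w)) (eigvec E k w).
rewrite p1 !mulr1; lra.
Qed.

Lemma step_decrease (dsp : measure_display)
    (T : measurableType dsp) (R : realType) (d : nat) (f : 'cV[R]_d -> R)
    (L M alpha : R) (x0 : 'cV[R]_d) (E : execution T R d) (eps_g eps_H : R)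
    (k : nat) (w : T) :
  0 < L -> 0 < M -> 0 < eps_g -> 0 < eps_H ->
  twice_differentiable f -> lipschitz_gradient L f -> lipschitz_hessian M f ->
  runs_algorithm E eps_g eps_H L M alpha x0 ->
  inexact_oracles E eps_g eps_H f -> coin E k w = 1 \/ coin E k w = -1 ->
  reached E eps_g eps_H k.+1 w ->
  f (iterate E k.+1 w) + R_eps eps_g eps_H L M <=
  f (iterate E k w) + coin E k w * curvature_slope f M E eps_g eps_H k w.
Proof.
move=> L0 M0 g0 H0 df lipg liph hrun orac s1 rw.
have [rk _] := reachedS rw.
rewrite /curvature_slope indicE.
have [small|large] := lerP (norm2 (grad_est E k w)) eps_g.
  have [req lam] := eigval_lt_of_reachedS rw small.
  have [_ p1] := run_hessian_oracle hrun req.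
  have [/andP[ca]] := run_curvature_step hrun req lam.
  rewrite le_min => /andP[_ ca'] ->; rewrite mem_set// mul1r.
  have := @curvature_step_decrease R d f M eps_H (curv_step E k w) (coin E k w)
    (iterate E k w) _ _ M0 df liph p1 (oracle_hessian orac req) s1.
  rewrite H0 ca -eigval_dot => /(_ isT) dec.
  apply: le_trans (dec _); first by rewrite lerD2l ge_min lexx orbT.
  (* Since the estimated eigenvalue is negative, [curv_step] being at most its absolute value means
     that the eigenvalue is at most minus the step. *)
  by rewrite lerNr -(ltr0_norm (lt_trans lam _)) ?oppr_lt0.
(* On a gradient step the indicator in the slope is zero, so the coin contributes nothing. *)
rewrite memNset; last by move=> [_ /=]; rewrite leNgt large.
rewrite mul0r mulr0 addr0 (run_gradient_step hrun rk large).
apply: le_trans (gradient_step_decrease L0 df.1 lipg _ (oracle_gradient orac rk)).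
  by rewrite lerD2l ge_min lexx.
by rewrite g0.
Qed.

(** * Summation over iterations, expectation bound and almost sure termination *)

Theorem theorem2p6 (R : realType) (d : nat)
  (f : 'cV[R]_d -> R) (fbar L M : R)
  (hL : 0 < L) (hM : 0 < M)
  (hf : twice_differentiable f)
  (hgrad : lipschitz_gradient L f)
  (hhess : lipschitz_hessian M f)
  (hfbar : forall x, fbar <= f x)
  (eps_g eps_H alpha : R)
  (heps_g : 0 < eps_g) (heps_H : 0 < eps_H)
  (halpha : eps_H <= alpha <= L)
  (x0 : 'cV[R]_d)
  (dsp : measure_display) (Omega : measurableType dsp)
  (P : probability Omega R)
  (E : execution Omega R d)
  (hrandom : random_execution E)
  (hcoins : fair_independent_coins E P)
  (hrun : runs_algorithm E eps_g eps_H L M alpha x0)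
  (horacles : inexact_oracles E eps_g eps_H f) :
  {ae P, forall w, (termination_time E eps_g eps_H w < +oo)%E} /\
  (\int[P]_w termination_time E eps_g eps_H w
     <= ((f x0 - fbar) / R_eps eps_g eps_H L M)%:E)%E.
Proof.
have r0 := R_eps_gt0 heps_g heps_H hL hM.
set r := R_eps eps_g eps_H L M in r0 *.
pose B k := [set w | reached E eps_g eps_H k w].
pose V k w := f (iterate E k w) - fbar.
have mhist k h : history E k h -> measurable_fun setT h by exact: hrandom.
have mB k : measurable (B k.+1).
  apply: (sigma_generated_sub (mhist k)).
  by apply: measurable_reached; exact: ltW.
have B0 : B 0%N = setT by apply/seteqP; split.
have {mB} mB k : measurable (B k) by case: k => [|k]; rewrite ?B0.
have mV k : measurable_fun setT (V k).
  apply: measurable_funB; last exact: measurable_cst.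
  apply: measurable_fun_comp_continuous => [i|x].
    by apply: (mhist k); exact: hist_iterate.
  by apply: differentiable_continuous; exact: hf.1.
have V0 k w : 0 <= V k w by rewrite subr_ge0.
have step k : (\int[P]_(w in B k.+1) (V k.+1 w)%:E + r%:E * P (B k.+1)
    <= \int[P]_(w in B k) (V k w)%:E)%E.
  have mcoin : measurable_fun setT (coin E k) by apply: (mhist k.+1); exact: hist_coin.
  have mslope : measurable_fun [set: generated_type (history E k)]
      (curvature_slope f M E eps_g eps_H k).
    by apply: measurable_curvature_slope => //; exact: ltW.
  have slopeC w : `|curvature_slope f M E eps_g eps_H k w|
      <= 2 * alpha / M * (4 / 3 * eps_g).
    by case/andP: halpha => Ha _; apply: curvature_slope_bound hrun horacles.
  have [fair1 fairN1] := coin_fair hcoins k.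
  (* Nonnegativity of [V k] allows shrinking [B k] to [B k.+1], the event on which a step is
     actually taken. *)
  apply: (@le_trans _ _ (\int[P]_(w in B k.+1) (V k w)%:E)%E); last first.
    apply: ge0_subset_integral => //.
    - by apply: measurable_funTS; exact/measurable_EFinP.
    - by move=> w _; rewrite lee_fin.
    - by move=> w /reachedS[].
  apply: (expected_decrease (mB _) (mV k) (mV k.+1)
    (measurable_funM mcoin (measurable_fun_generated (mhist k) mslope)) (V0 k)
    (V0 k.+1) (ltW r0)).
  - by move=> w; rewrite /= normrM; case: (coin_sign hcoins k w) => ->;
      rewrite ?normrN normr1 mul1r; exact: slopeC.
  - have FB : sigma_generated (history E k) (B k.+1).
      by apply: measurable_reached; exact: ltW.
    exact: (integral_fair_coin (mhist k) mcoin (coin_sign hcoins k) fair1 fairN1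
      (coin_independent hcoins (k := k)) mslope FB slopeC).
  - move=> w Bw.
    have := step_decrease hL hM heps_g heps_H hf hgrad hhess hrun horacles
      (coin_sign hcoins k w) Bw.
    rewrite /V /= -/r; lra.
have mtime : measurable_fun setT (termination_time E eps_g eps_H).
  rewrite (funext (termination_time_series E eps_g eps_H)).
  apply: ge0_emeasurable_sum => [k w _ _|k _]; first by rewrite lee_fin indicE.
  by apply/measurable_EFinP; apply: measurable_indic; exact: mB.
have time0 w : (0 <= termination_time E eps_g eps_H w)%E.
  by rewrite termination_time_series nneseries_ge0// => k _ _; rewrite lee_fin indicE.
have bound : (\int[P]_w termination_time E eps_g eps_H w
    <= ((f x0 - fbar) / r)%:E)%E.
  (* Exchanging sum and integral of nonnegative terms gives the expectation as the sum of the
     [P (B k.+1)]. *)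
  under eq_integral do rewrite termination_time_series.
  rewrite integral_nneseries//; last first.
    by move=> k; apply/measurable_EFinP; apply: measurable_indic; exact: mB.
  have intB k : (\int[P]_w (\1_(B k.+1) w)%:E = P (B k.+1))%E.
    by rewrite integral_indic ?setIT.
  rewrite (eq_eseriesr (fun k _ => intB k)).
  apply: le_trans (nneseries_le_of_decrease r0 _ _ step) _ => [k|k|].
  - by apply: integral_ge0 => w _; rewrite lee_fin.
  - exact: measure_ge0.
  (* The telescoping starts from the integral of [V 0] over the whole space, a constant because the
     initial point is deterministic. *)
  rewrite B0 (eq_integral (cst (f x0 - fbar)%:E)) => [|w _]; last first.
    by rewrite /V (run_init hrun).
  rewrite integral_cst// [X in (_ * (_ * X))%E](@probability_setT _ _ _ P).
  by rewrite mule1 -EFinM mulrC.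
split=> //.
(* A nonnegative variable with finite expectation is finite almost surely. *)
have int : P.-integrable setT (termination_time E eps_g eps_H).
  apply/integrableP; split=> //.
  under eq_integral do rewrite gee0_abs//.
  by rewrite (le_lt_trans bound)// ltry.
have := integrable_ae measurableT int.
by apply: filterS => w /(_ I); rewrite ge0_fin_numE.
Qed.
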